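(* Let $f:\mathbb{R}^n\to\mathbb{R}$ be a piecewise-affine function with abs-normal form data $s,c,b,Z,L,J,Y$ (with $m=1$), and let $\tilde c,\tilde b,\tilde L,\tilde Y,\tilde Z,\tilde J$ be the associated auxiliary matrices and vectors. Let $e\in\mathbb{R}^s$ be the vector of ones, and suppose some value $\mu>0$ is known such that any solution (globally optimal feasible point) $(x^\dagger,w^\dagger)$ of the problem $$\min_{x\in\mathbb{R}^n,\;w\in\mathbb{R}^s}\ \tilde b+\tilde J x+\tilde Y w\qquad\text{subject to}\qquad 0\le w\perp \tilde c+\tilde Z x+\tilde L w\ge 0$$ must satisfy both $w^\dagger\le\mu e$ and $\tilde c+\tilde Z x^\dagger+\tilde L w^\dagger\le\mu e$. Then $x^\ast\in\mathbb{R}^n$ is a (global) minimum of $f$ if and only if, for some $w^\ast$ and $y^\ast$, $(x^\ast,w^\ast,y^\ast)$ solves (is a globally optimal feasible point of) the mixed-integer linear program $$\begin{aligned}\min_{x\in\mathbb{R}^n,\,w\in\mathbb{R}^s,\,y}\quad & \tilde b+\tilde J x+\tilde Y w\\ \text{subject to}\quad & 0\le w\le \mu y,\\ & 0\le \tilde c+\tilde Z x+\tilde L w\le \mu(e-y),\\ & y\in\{0,1\}^s.\end{aligned}$$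
   Context: A function $f:\mathbb{R}^n\to\mathbb{R}^m$ is piecewise affine if it is continuous and its values are chosen from finitely many affine functions, i.e. there are finitely many affine maps $f^1,\dots,f^k$ with $f(x)\in\{f^1(x),\dots,f^k(x)\}$ for every $x$. A global minimum of $f$ is a point $x^\ast$ with $f(x^\ast)\le f(x)$ for all $x\in\mathbb{R}^n$. For a vector $z$, $|z|$ denotes the componentwise absolute value; vector inequalities are componentwise. For vectors $p,q$ of the same size, $0\le p\perp q\ge 0$ means $p\ge0$, $q\ge0$ and $p^{T}q=0$. Abs-normal form: $f$ has abs-normal form data consisting of $s\in\mathbb{N}$, matrices $Z\in\mathbb{R}^{s\times n}$, $J\in\mathbb{R}^{m\times n}$, $Y\in\mathbb{R}^{m\times s}$, a strictly lower triangular matrix $L\in\mathbb{R}^{s\times s}$, and vectors $c\in\mathbb{R}^s$, $b\in\mathbb{R}^m$, if for every $x\in\mathbb{R}^n$ the unique vector $z\in\mathbb{R}^s$ with $z=c+Zx+L|z|$ satisfies $f(x)=b+Jx+Y|z|$. Here $m=1$. Auxiliary quantities: $\tilde c:=(I-L)^{-1}c$, $\tilde b:=b+Y\tilde c$, $\tilde L:=(I-L)^{-1}(I+L)$, $\tilde Y:=Y(I+\tilde L)$, $\tilde Z:=(I-L)^{-1}Z$, $\tilde J:=J+Y\tilde Z$, where $I$ is the $s\times s$ identity matrix. ($I-L$ is unit lower triangular, hence invertible.)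
   Formalization: It is additionally assumed that the complementarity problem has a solution; otherwise the condition on μ is vacuous and the claim fails, e.g. for f(x) = -|x|, where the mixed-integer program has optimal points x = ±μ but f has no global minimum. *)

(* Defs.v *)
From HB Require Import structures.
From mathcomp Require Export all_boot all_order all_algebra.
From mathcomp Require Export classical_sets reals topology normedtype.

Set Implicit Arguments.
Unset Strict Implicit.
Unset Printing Implicit Defensive.

Export Order.TTheory GRing.Theory Num.Theory.
Export numFieldNormedType.Exports.

#[global] Open Scope ring_scope.

Definition lev (R : realType) (k : nat) (p q : 'cV[R]_k) : Prop :=
  forall i, p i 0 <= q i 0.

Notation "p <=v q" := (lev p q) (at level 70, no associativity) : ring_scope.

(* The entrywise absolute value; the notation `|z| on matrices is the
   sup norm instead. *)
Definition absv (R : realType) (k : nat) (z : 'cV[R]_k) : 'cV[R]_k :=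
  map_mx Num.norm z.

Definition onesv (R : realType) (k : nat) : 'cV[R]_k := const_mx 1.

Definition binaryv (R : realType) (k : nat) (y : 'cV[R]_k) : Prop :=
  forall i, y i 0 = 0 \/ y i 0 = 1.

Definition complementary (R : realType) (k : nat) (p q : 'cV[R]_k) : Prop :=
  [/\ 0 <=v p, 0 <=v q & p^T *m q = 0].

Definition piecewise_affine (R : realType) (n m : nat)
    (f : 'cV[R]_n -> 'cV[R]_m) : Prop :=
  continuous f /\
  exists (k : nat) (A : 'I_k -> 'M[R]_(m, n)) (a : 'I_k -> 'cV[R]_m),
    forall x, exists i, f x = A i *m x + a i.

Definition global_min (R : realType) (n : nat) (f : 'cV[R]_n -> R)
    (xs : 'cV[R]_n) : Prop :=
  forall x, f xs <= f x.

Definition optimal (R : realType) (T : Type) (feasible : T -> Prop)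
    (obj : T -> R) (t : T) : Prop :=
  feasible t /\ forall t', feasible t' -> obj t <= obj t'.

Record anf_data (R : realType) (n m s : nat) := AnfData {
  anf_c : 'cV[R]_s;
  anf_b : 'cV[R]_m;
  anf_Z : 'M[R]_(s, n);
  anf_L : 'M[R]_s;
  anf_J : 'M[R]_(m, n);
  anf_Y : 'M[R]_(m, s);
  anf_L_strict : forall i j : 'I_s, (i <= j)%N -> anf_L i j = 0
}.

Section AbsNormalForm.
Variables (R : realType) (n m s : nat) (D : anf_data R n m s).

Definition switching (x : 'cV[R]_n) (z : 'cV[R]_s) : Prop :=
  z = anf_c D + anf_Z D *m x + anf_L D *m absv z.

Lemma switching_exists_unique (x : 'cV[R]_n) : exists! z, switching x z.
Proof.
pose T z := anf_c D + anf_Z D *m x + anf_L D *m absv z.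
have T_agree k (u v : 'cV[R]_s) : (forall i : 'I_s, (i < k)%N -> u i 0 = v i 0) ->
    forall i : 'I_s, (i < k.+1)%N -> T u i 0 = T v i 0.
  move=> uv i ik; rewrite !mxE; congr (_ + _); apply: eq_bigr => j _.
  rewrite !mxE; case: (leqP i j) => ij; first by rewrite anf_L_strict ?mul0r.
  by rewrite uv // (leq_trans ij).
have T_iter k : forall i : 'I_s, (i < k)%N ->
    iter k T 0 i 0 = iter k.+1 T 0 i 0.
  by elim: k => [|k IH] // i ik; apply: T_agree ik.
exists (iter s T 0); split.
  by apply/colP => i; rewrite {1}T_iter.
move=> z zT; apply/colP => i.
have agree k : forall j : 'I_s, (j < k)%N -> iter k T 0 j 0 = z j 0.
  by elim: k => [|k IH] // j jk; rewrite zT; apply: T_agree jk.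
exact: agree.
Qed.

Definition has_abs_normal_form (f : 'cV[R]_n -> 'cV[R]_m) : Prop :=
  forall x z, switching x z -> f x = anf_b D + anf_J D *m x + anf_Y D *m absv z.

Definition tilde_c : 'cV[R]_s := invmx (1%:M - anf_L D) *m anf_c D.
Definition tilde_b : 'cV[R]_m := anf_b D + anf_Y D *m tilde_c.
Definition tilde_L : 'M[R]_s := invmx (1%:M - anf_L D) *m (1%:M + anf_L D).
Definition tilde_Y : 'M[R]_(m, s) := anf_Y D *m (1%:M + tilde_L).
Definition tilde_Z : 'M[R]_(s, n) := invmx (1%:M - anf_L D) *m anf_Z D.
Definition tilde_J : 'M[R]_(m, n) := anf_J D + anf_Y D *m tilde_Z.

Lemma unitmx_1BL : 1%:M - anf_L D \in unitmx.
Proof.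
have tr : is_trig_mx (1%:M - anf_L D).
  apply/is_trig_mxP => i j ij; rewrite !mxE (anf_L_strict D (ltnW ij)) subr0.
  by rewrite -val_eqE ltn_eqF.
rewrite unitmxE det_trig // big1 ?unitr1 // => i _.
by rewrite !mxE eqxx anf_L_strict // subr0.
Qed.

Definition slack (x : 'cV[R]_n) (w : 'cV[R]_s) : 'cV[R]_s :=
  tilde_c + tilde_Z *m x + tilde_L *m w.

Definition mpcc_feasible (xw : 'cV[R]_n * 'cV[R]_s) : Prop :=
  complementary xw.2 (slack xw.1 xw.2).

Definition milp_feasible (mu : R)
    (xwy : 'cV[R]_n * 'cV[R]_s * 'cV[R]_s) : Prop :=
  let: (x, w, y) := xwy in
  [/\ 0 <=v w /\ w <=v mu *: y,
      0 <=v slack x w /\ slack x w <=v mu *: (onesv R s - y)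
    & binaryv y].

End AbsNormalForm.

Section Objective.
Variables (R : realType) (n s : nat) (D : anf_data R n 1 s).

Definition objective (x : 'cV[R]_n) (w : 'cV[R]_s) : R :=
  (tilde_b D + tilde_J D *m x + tilde_Y D *m w) 0 0.

(* The property "every solution (x, w) satisfies w <= mu e and slack <= mu e"
   holds vacuously when the objective is unbounded below, and then the
   mixed-integer program may have optima although the function has no minimum:
   for f x = - |x| (n = s = 1, Z = 1, Y = -1, c = b = L = J = 0) and any mu > 0
   its optimal points have x = mu or x = - mu. Hence results using that
   property must also assume that a solution exists. *)
Definition mpcc_solution (x : 'cV[R]_n) (w : 'cV[R]_s) : Prop :=
  optimal (mpcc_feasible D) (fun xw => objective xw.1 xw.2) (x, w).

Definition milp_solution (mu : R) (x : 'cV[R]_n) (w y : 'cV[R]_s) : Prop :=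
  optimal (milp_feasible D mu) (fun xwy => objective xwy.1.1 xwy.1.2) (x, w, y).

End Objective.

(* Main.v *)
Require Import Defs.
From mathcomp Require Import lra.

(* Writing z = v - w with w, v >= 0 complementary, so that |z| = v + w, turns
   the switching equation z = c + Z x + L |z| into v = slack x w and f x into
   the objective at (x, w). Hence the complementarity problem minimizes f, one
   feasible w above every x. The binary y records which factor of each
   complementary pair may be nonzero; the bounds with mu cut off feasible
   points but, by the choice of mu, no optimal ones. *)

(** For nonnegative vectors the inner product is a sum of nonnegative terms, so it vanishes only if
    each term does. *)
Lemma complementaryP {R : realType} {k : nat} {p q : 'cV[R]_k} :
  complementary p q <->
  forall i, [/\ 0 <= p i 0, 0 <= q i 0 & p i 0 * q i 0 = 0].
Proof.
have dotE : (p^T *m q) 0 0 = \sum_i p i 0 * q i 0.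
  by rewrite mxE; apply: eq_bigr => i _; rewrite mxE.
split=> [[p0 q0 pq] i | pq].
  have pi0 j : 0 <= p j 0 by have := p0 j; rewrite mxE.
  have qi0 j : 0 <= q j 0 by have := q0 j; rewrite mxE.
  split=> //; move: dotE; rewrite pq mxE => /esym sum0.
  by apply: (psumr_eq0P _ sum0) => // j _; apply: mulr_ge0.
split=> [i|i|]; [by case: (pq i); rewrite mxE | by case: (pq i); rewrite mxE|].
apply/matrixP => i j; rewrite !ord1 dotE mxE big1 // => l _.
by case: (pq l).
Qed.

Lemma complementary_absv {R : realType} {k : nat} {p q : 'cV[R]_k} :
  complementary p q -> absv (q - p) = q + p.
Proof.
move=> /complementaryP pq; apply/colP => i; rewrite !mxE.
case: (pq i) => p0 q0 /eqP; rewrite mulf_eq0 => /orP[] /eqP ->.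
  by rewrite subr0 addr0 ger0_norm.
by rewrite sub0r add0r normrN ger0_norm.
Qed.

Lemma absv_decomp {R : realType} {k : nat} (z : 'cV[R]_k) :
  exists p q, [/\ complementary p q, q - p = z & q + p = absv z].
Proof.
(* [p] is the negative part of [z] and [q] its positive part. *)
exists (\col_i Num.max 0 (- z i 0)), (\col_i Num.max 0 (z i 0)); split.
- apply/complementaryP => i; rewrite !mxE.
  by case: (lerP 0 (z i 0)) => ?; case: (lerP 0 (- z i 0)) => ?; split; nra.
- apply/colP => i; rewrite !mxE.
  by case: (lerP 0 (z i 0)) => ?; case: (lerP 0 (- z i 0)) => ?; lra.
apply/colP => i; rewrite !mxE.
case: (lerP 0 (z i 0)) => zi; case: (lerP 0 (- z i 0)) => ?.
- by rewrite (ger0_norm zi); lra.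
- by rewrite (ger0_norm zi); lra.
- by rewrite (ltr0_norm zi); lra.
- by rewrite (ltr0_norm zi); lra.
Qed.

Section AbsNormalForm.
Context {R : realType} {n m s : nat} {D : anf_data R n m s}.

(** Multiplied by the invertible [I - L], the left side reads [(I - L) v = c + Z x + (I + L) w];
    moving terms across gives the right side. This is pure linear algebra: signs and complementarity
    enter only when [v + w] is identified with an absolute value. *)
Lemma slackP (x : 'cV[R]_n) (w v : 'cV[R]_s) :
  v = slack D x w <->
  v - w = anf_c D + anf_Z D *m x + anf_L D *m (v + w).
Proof.
have U := unitmx_1BL D.
have slackE : slack D x w =
    invmx (1%:M - anf_L D) *m
      (anf_c D + anf_Z D *m x + (w + anf_L D *m w)).
  by rewrite /slack /tilde_c /tilde_Z /tilde_L -!mulmxA -!mulmxDr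
             [X in _ = _ *m (_ + X)](_ : _ = (1%:M + anf_L D) *m w)
             // mulmxDl mul1mx.
rewrite slackE [anf_L D *m (v + w)]mulmxDr.
have shift : v = invmx (1%:M - anf_L D) *m
      (anf_c D + anf_Z D *m x + (w + anf_L D *m w)) <->
    v - anf_L D *m v = anf_c D + anf_Z D *m x + (w + anf_L D *m w).
  have <- : (1%:M - anf_L D) *m v = v - anf_L D *m v.
    by rewrite mulmxBl mul1mx.
  by split=> [->|<-]; rewrite ?mulKVmx ?mulKmx.
rewrite shift; split=> /colP E; apply/colP => i;
  by move: (E i); rewrite !mxE; lra.
Qed.

Lemma mpcc_feasible_switching {x : 'cV[R]_n} {w : 'cV[R]_s} :
  mpcc_feasible D (x, w) -> switching D x (slack D x w - w).
Proof. by move=> /complementary_absv /= E; rewrite /switching E; apply/slackP. Qed.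

Lemma mpcc_feasible_exists (x : 'cV[R]_n) : exists w, mpcc_feasible D (x, w).
Proof.
have [z [zx _]] := switching_exists_unique D x.
have [w [v [wv vBw vDw]]] := absv_decomp z.
exists w; rewrite /mpcc_feasible /=.
by have <- : v = slack D x w by apply/slackP; rewrite vBw vDw.
Qed.

(** Where [y] is 0 the bounds squeeze the entry of [w] to 0; where it is 1 they do so to the
    slack. *)
Lemma milp_feasible_mpcc {mu : R} {x : 'cV[R]_n} {w y : 'cV[R]_s} :
  milp_feasible D mu (x, w, y) -> mpcc_feasible D (x, w).
Proof.
move=> [[w0 w_le] [v0 v_le] y01]; apply/complementaryP => i /=.
move: (w0 i) (w_le i) (v0 i) (v_le i); rewrite !mxE => {}w0 {}w_le {}v0 {}v_le.
split=> //; case: (y01 i) => yi; rewrite yi in w_le v_le.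
  have -> : w i 0 = 0 by lra.
  by rewrite mul0r.
by apply/eqP; rewrite mulf_eq0; apply/orP; right; apply/eqP; lra.
Qed.

Lemma mpcc_feasible_milp (mu : R) (x : 'cV[R]_n) (w : 'cV[R]_s) :
  mpcc_feasible D (x, w) ->
  w <=v mu *: onesv R s -> slack D x w <=v mu *: onesv R s ->
  exists y, milp_feasible D mu (x, w, y).
Proof.
(* [y] marks the positive entries of [w]. There complementarity makes the slack 0, as the bound
   [mu * (1 - 1)] demands; elsewhere the slack only has to stay below [mu]. *)
move=> F w_le v_le; exists (\col_i (0 < w i 0)%R%:R).
have [/= w0 v0 _] := F; move/complementaryP: F => /= wv.
split; [split=> // i | split=> // i | move=> i; rewrite mxE].
- move: (w_le i); rewrite !mxE; case: ltP => // wi _.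
  by rewrite mulr0.
- have -> : (mu *: (onesv R s - \col_j (0 < w j 0)%R%:R)) i 0 =
      mu * (1 - (0 < w i 0)%R%:R) by rewrite !mxE.
  case: ltP => [wi|_].
    case: (wv i) => _ _ /eqP; rewrite mulf_eq0 gt_eqF //= => /eqP ->.
    by rewrite subrr mulr0.
  rewrite subr0 mulr1; have := v_le i.
  by have -> : (mu *: onesv R s) i 0 = mu by rewrite !mxE mulr1.
- by case: ltP; [right | left].
Qed.

End AbsNormalForm.

(** Expanding [Y (slack + w)] yields exactly the terms by which [tilde_b] and [tilde_J] differ from
    [b] and [J], plus [Y (I + tilde_L) w], which is [tilde_Y w]. *)
Lemma objectiveE (R : realType) (n s : nat) (D : anf_data R n 1 s)
    (x : 'cV[R]_n) (w : 'cV[R]_s) :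
  objective D x w =
  (anf_b D + anf_J D *m x + anf_Y D *m (slack D x w + w)) 0 0.
Proof.
rewrite /objective /tilde_b /tilde_J /tilde_Y /slack; congr (fun_of_matrix _ 0 0).
rewrite !(mulmxDr, mulmxDl, mulmx1, mulmxA).
by apply/matrixP => i j; rewrite ![(_ + _ : 'M__) i j]mxE; lra.
Qed.

Lemma objective_mpcc_feasible (R : realType) (n s : nat) (f : 'cV[R]_n -> R)
    (D : anf_data R n 1 s) (x : 'cV[R]_n) (w : 'cV[R]_s) :
  has_abs_normal_form D (fun x => (f x)%:M) ->
  mpcc_feasible D (x, w) -> objective D x w = f x.
Proof.
move=> f_anf F; rewrite objectiveE -(complementary_absv F) /=.
by rewrite -(f_anf _ _ (mpcc_feasible_switching F)) mxE.
Qed.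

Theorem corollary4p1 (R : realType) (n s : nat) (f : 'cV[R]_n -> R)
    (D : anf_data R n 1 s)
    (f_pa : piecewise_affine (fun x => (f x)%:M : 'cV[R]_1))
    (f_anf : has_abs_normal_form D (fun x => (f x)%:M))
    (mpcc_solvable : exists x w, mpcc_solution D x w)
    (mu : R) (mu_gt0 : 0 < mu)
    (mu_bound : forall x w, mpcc_solution D x w ->
       w <=v mu *: onesv R s /\ slack D x w <=v mu *: onesv R s)
    (xs : 'cV[R]_n) :
  global_min f xs <-> exists w y, milp_solution D mu xs w y.
Proof.
have objE x w : mpcc_feasible D (x, w) -> objective D x w = f x.
  exact: objective_mpcc_feasible.
have sol_milp x w : mpcc_solution D x w -> exists y, milp_feasible D mu (x, w, y).
  by move=> S; have [? ?] := mu_bound _ _ S; apply: mpcc_feasible_milp => //; case: S.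
split=> [xs_min | [w [y [F opt]]] x].
  have [w F] := mpcc_feasible_exists (D := D) xs.
  have S : mpcc_solution D xs w.
    by split=> // -[x' w'] F' /=; rewrite !objE.
  have [y Fy] := sol_milp _ _ S.
  (* Any competitor is feasible for the complementarity problem, so its objective is a value of
     [f]. *)
  exists w, y; split=> // -[[x' w'] y'] /milp_feasible_mpcc F' /=.
  by rewrite !objE.
(* A solution [(x0, w0)] of the complementarity problem survives the [mu] bounds, so it links the
   two problems: the mixed-integer optimum is at most its value, which is at most [f x]. *)
have [x0 [w0 S]] := mpcc_solvable.
have [y0 F0] := sol_milp _ _ S.
have [w' F'] := mpcc_feasible_exists (D := D) x.
rewrite -(objE _ _ (milp_feasible_mpcc F)) -(objE _ _ F').
by apply: le_trans (opt _ F0) _; case: S => _ /(_ _ F').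
Qed.
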